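(* Let $f:\mathbb{R}^n\to\mathbb{R}$ be continuously differentiable and $\mu$-strongly convex with $\mu>0$, let $\mathbf{u}^{\ast}$ be its unique minimizer, and suppose that $\nabla f\in\mathcal{H}(\alpha,\beta,\delta)$ for some $\beta,\delta>0$ and $\alpha\in(0,1]$. Let $\mathbf{u}_0\in\mathbb{R}^n$ satisfy $\|\mathbf{u}_0-\mathbf{u}^{\ast}\|\le\delta$. Then for every sufficiently small $\varepsilon>0$ (that is, there is $\varepsilon_0>0$ such that for every $\varepsilon\in(0,\varepsilon_0)$) the following holds. Let $\{\mathbf{u}_k\}$ be the sequence generated from $\mathbf{u}_0$ by the gradient descent method $\mathbf{u}_{k+1}=\mathbf{u}_k-\tau\nabla f(\mathbf{u}_k)$ with the fixed stepsize $$\tau=\mu\beta^{-2}\varepsilon^{2-2\alpha}.$$ Then after at most $$\left\lceil \frac{2\beta^2}{\mu^2}\log\left(\frac{\|\mathbf{u}_0-\mathbf{u}^{\ast}\|}{\varepsilon}\right)\varepsilon^{2\alpha-2}\right\rceil$$ iterations, an iterate $\mathbf{u}_k$ satisfying $\|\mathbf{u}_k-\mathbf{u}^{\ast}\|\le\varepsilon$ is reached.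
   Context: $\|\cdot\|$ is the $\ell_2$ norm on $\mathbb{R}^n$. A continuously differentiable $f$ is $\mu$-strongly convex if $f(\mathbf{u})-f(\mathbf{v})\ge\nabla f(\mathbf{v})^{\top}(\mathbf{u}-\mathbf{v})+\frac{\mu}{2}\|\mathbf{u}-\mathbf{v}\|^2$ for all $\mathbf{u},\mathbf{v}\in\mathbb{R}^n$. For $\alpha\in(0,1]$ and $\beta,\delta>0$, $\mathcal{H}(\alpha,\beta,\delta)$ denotes the class of functions $g:\mathbb{R}^n\to\mathbb{R}^n$ (locally $\alpha$-Hölder continuous) such that $\|g(\mathbf{u})-g(\mathbf{v})\|\le\beta\|\mathbf{u}-\mathbf{v}\|^{\alpha}$ for all $\mathbf{u},\mathbf{v}\in\mathbb{R}^n$ with $\|\mathbf{u}-\mathbf{v}\|\le\delta$. *)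

(* Defs.v *)
(* MathComp-Analysis, over an arbitrary R : realType.  R^n is 'rV[R]_n. *)
From HB Require Import structures.
From mathcomp Require Import all_boot all_order all_algebra.
From mathcomp Require Import all_classical all_reals all_analysis.

Set Implicit Arguments.
Unset Strict Implicit.
Unset Printing Implicit Defensive.

Import Order.TTheory GRing.Theory Num.Theory.
Import numFieldNormedType.Exports.

Local Open Scope classical_set_scope.
Local Open Scope ring_scope.

Definition dot (R : realType) (n : nat) (u v : 'rV[R]_n) : R :=
  \sum_(i < n) u 0 i * v 0 i.

(* The library norm `|u| on 'rV[R]_n is the sup norm, hence this definition. *)
Definition l2norm (R : realType) (n : nat) (u : 'rV[R]_n) : R :=
  Num.sqrt (\sum_(i < n) u 0 i ^+ 2).

Definition gradient (R : realType) (n : nat) (f : 'rV[R]_n -> R)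
    (x : 'rV[R]_n) : 'rV[R]_n :=
  \row_(i < n) 'D_(delta_mx 0 i) f x.

(* The derivative and continuity below refer to the sup-norm topology of
   'rV[R]_n, which coincides with the l2 topology. *)
Definition continuously_differentiable (R : realType) (n : nat)
    (f : 'rV[R]_n -> R) : Prop :=
  (forall x, differentiable f x) /\ continuous (gradient f).

Definition strongly_convex (R : realType) (n : nat) (mu : R)
    (f : 'rV[R]_n -> R) : Prop :=
  forall u v : 'rV[R]_n,
    dot (gradient f v) (u - v) + mu / 2 * l2norm (u - v) ^+ 2 <= f u - f v.

Definition holder_class (R : realType) (n : nat) (alpha beta delta : R) :
    set ('rV[R]_n -> 'rV[R]_n) :=
  [set g | forall u v : 'rV[R]_n, l2norm (u - v) <= delta ->
     l2norm (g u - g v) <= beta * l2norm (u - v) `^ alpha].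

Definition minimizer (R : realType) (n : nat) (f : 'rV[R]_n -> R)
    (x : 'rV[R]_n) : Prop :=
  forall y : 'rV[R]_n, f x <= f y.

Definition gradient_descent (R : realType) (n : nat) (f : 'rV[R]_n -> R)
    (tau : R) (u0 : 'rV[R]_n) (k : nat) : 'rV[R]_n :=
  iter k (fun u => u - tau *: gradient f u) u0.

(* Main.v *)
Require Import Defs.
From HB Require Import structures.
From mathcomp Require Import all_boot all_order all_algebra.
From mathcomp Require Import all_classical all_reals all_analysis.
From mathcomp Require Import ring lra.

(** Write d_k for the distance from the k-th iterate to the minimizer.  The
argument is the usual quadratic expansion
  d_(k+1)^2 = d_k^2 - 2 tau <grad f u_k, u_k - ustar> + tau^2 |grad f u_k|^2.
Strong convexity, used both at u_k and at ustar (where the gradient vanishes),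
bounds the inner product by mu d_k^2 from below ([strongly_convex_coercive]).  As
long as d_k <= delta, the Hoelder condition between u_k and ustar bounds
|grad f u_k| above by beta d_k^alpha.

For alpha < 1 the resulting term d_k^(2 alpha) is not dominated by d_k^2 near
the minimizer, so this estimate yields a contraction all the way down for no
fixed stepsize.  But outside the eps-ball one has eps^(2 - 2 alpha) d_k^(2 alpha) <= d_k^2, and the
stepsize tau = mu beta^-2 eps^(2 - 2 alpha) is chosen so that this makes the
quadratic term at most tau mu d_k^2, half of the gain of the linear term.
Hence, while eps <= d_k <= delta, each step multiplies d_k^2 by at most
1 - tau mu <= exp (- tau mu) ([gradient_step_contracts]); in particular the
iterates never leave the delta-ball.

If no iterate before step K enters the eps-ball, then d_K^2 is at most
exp (- K tau mu) d_0^2, which is at most eps^2 as soon as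
K >= 2 ln (d_0 / eps) / (tau mu), the announced number of iterations.  The
condition that eps be small is only eps < d_0, which makes the logarithm
positive; when d_0 = 0 the initial point is already the minimizer. *)

Set Implicit Arguments.
Unset Strict Implicit.
Unset Printing Implicit Defensive.

Import Order.TTheory GRing.Theory Num.Theory.
Import numFieldNormedType.Exports.

Local Open Scope classical_set_scope.
Local Open Scope ring_scope.

Lemma l2norm_ge0 (R : realType) (n : nat) (u : 'rV[R]_n) : 0 <= l2norm u.
Proof. exact: sqrtr_ge0. Qed.

Lemma sqr_l2norm (R : realType) (n : nat) (u : 'rV[R]_n) :
  l2norm u ^+ 2 = dot u u.
Proof.
rewrite sqr_sqrtr; last by apply: sumr_ge0 => i _; exact: sqr_ge0.
by apply: eq_bigr => i _; rewrite expr2.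
Qed.

Lemma l2normN (R : realType) (n : nat) (u : 'rV[R]_n) :
  l2norm (- u) = l2norm u.
Proof.
by congr Num.sqrt; apply: eq_bigr => i _; rewrite mxE sqrrN.
Qed.

Lemma dotNr (R : realType) (n : nat) (u v : 'rV[R]_n) :
  dot u (- v) = - dot u v.
Proof. by rewrite -sumrN; apply: eq_bigr => i _; rewrite mxE mulrN. Qed.

Lemma dot0l (R : realType) (n : nat) (v : 'rV[R]_n) : dot 0 v = 0.
Proof. by apply: big1 => i _; rewrite mxE mul0r. Qed.

Lemma sqr_l2normBZ (R : realType) (n : nat) (u g : 'rV[R]_n) (t : R) :
  l2norm (u - t *: g) ^+ 2
  = l2norm u ^+ 2 - 2 * t * dot g u + t ^+ 2 * l2norm g ^+ 2.
Proof.
rewrite !sqr_l2norm /dot !mulr_sumr -sumrB -big_split /=.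
by apply: eq_bigr => i _; rewrite !mxE; ring.
Qed.

(** Fermat's rule, by restriction to the line through [x] with direction
[v]. *)
Lemma derive_minimizer (R : realType) (n : nat) (f : 'rV[R]_n -> R)
    (x v : 'rV[R]_n) :
  (forall y, differentiable f y) -> minimizer f x -> 'D_v f x = 0.
Proof.
move=> df xmin.
pose g (t : R) : R := f (t *: v + x).
have dg t : derivable g t 1.
  apply/derivable1_diffP.
  rewrite (_ : g = f \o (fun t => t *: v + x))//.
  by apply: differentiable_comp; [exact: differentiableD | exact: df].
have [] : is_derive (0 : R) 1 g 0.
  apply: (@derive1_at_min R g (-1) 1); rewrite ?in_itv/= ?ltrN10 ?ltr01 //.
  by move=> t _; rewrite /g scale0r add0r; exact: xmin.
move=> _ <-; rewrite /derive.
set F := (F in lim (F @ _)); set G := (G in _ = lim (G @ _)).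
suff -> : F = G by [].
by apply/funext => h; rewrite /F /G /g /= addr0 scale0r add0r [h *: 1]mulr1.
Qed.

Lemma gradient_minimizer (R : realType) (n : nat) (f : 'rV[R]_n -> R)
    (x : 'rV[R]_n) :
  (forall y, differentiable f y) -> minimizer f x -> gradient f x = 0.
Proof. by move=> df xmin; apply/rowP => i; rewrite !mxE derive_minimizer. Qed.

(** Half of the bound comes from the strong convexity inequality at [v], the
other half from the quadratic growth of [f] away from its minimizer. *)
Lemma strongly_convex_coercive (R : realType) (n : nat) (f : 'rV[R]_n -> R)
    (mu : R) (ustar v : 'rV[R]_n) :
  strongly_convex mu f -> gradient f ustar = 0 ->
  mu * l2norm (v - ustar) ^+ 2 <= dot (gradient f v) (v - ustar).
Proof.
move=> f_sc g0.
have growth := f_sc v ustar; rewrite g0 dot0l in growth.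
have := f_sc ustar v; rewrite -[ustar - v]opprB l2normN dotNr.
lra.
Qed.

(** Outside the eps-ball the sublinear growth of the gradient is harmless: the
missing factor [d `^ (2 - 2 * alpha)] is supplied by [eps]. *)
Lemma powR_le_sqr (R : realType) (alpha eps d : R) :
  0 < eps -> alpha <= 1 -> eps <= d ->
  eps `^ (2 - 2 * alpha) * (d `^ alpha) ^+ 2 <= d ^+ 2.
Proof.
move=> eps_gt0 alpha_le1 eps_le.
have d_gt0 : 0 < d by exact: lt_le_trans eps_le.
have -> : d ^+ 2 = d `^ (2 - 2 * alpha) * (d `^ alpha) ^+ 2.
  rewrite -!powR_mulrn ?powR_ge0 ?ltW// -powRrM -powRD.
    by congr powR; ring.
  by apply/implyP => _; rewrite gt_eqF.
apply: ler_wpM2r; first exact: sqr_ge0.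
by apply: ge0_ler_powR; rewrite ?nnegrE//; lra.
Qed.

Lemma gradient_step_contracts (R : realType) (n : nat) (f : 'rV[R]_n -> R)
    (mu alpha beta delta eps tau : R) (ustar u : 'rV[R]_n) :
  0 < mu -> strongly_convex mu f -> gradient f ustar = 0 ->
  alpha <= 1 -> 0 < beta -> holder_class alpha beta delta (gradient f) ->
  0 < eps -> eps <= l2norm (u - ustar) -> l2norm (u - ustar) <= delta ->
  tau = mu * beta ^- 2 * eps `^ (2 - 2 * alpha) ->
  l2norm (u - tau *: gradient f u - ustar) ^+ 2
  <= expR (- (tau * mu)) * l2norm (u - ustar) ^+ 2.
Proof.
move=> mu_gt0 f_sc g0 alpha_le1 beta_gt0 fH eps_gt0 eps_le le_delta tauE.
have tau_gt0 : 0 < tau.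
  by rewrite tauE !mulr_gt0 ?invr_gt0 ?exprn_gt0 ?powR_gt0.
have coercive := strongly_convex_coercive u f_sc g0.
have grad_le := fH u ustar le_delta; rewrite g0 subr0 in grad_le.
have := powR_le_sqr eps_gt0 alpha_le1 eps_le.
set d := l2norm (u - ustar) in eps_le le_delta coercive grad_le *.
set p := eps `^ _; set q := d `^ _ in grad_le * => pow_le.
have quad_le : tau ^+ 2 * l2norm (gradient f u) ^+ 2 <= tau * mu * d ^+ 2.
  apply: (@le_trans _ _ (tau ^+ 2 * (beta * q) ^+ 2)).
    apply: ler_wpM2l; first exact: sqr_ge0.
    by rewrite ler_sqr ?nnegrE ?l2norm_ge0// mulr_ge0 ?powR_ge0// ltW.
  have -> : tau ^+ 2 * (beta * q) ^+ 2 = tau * mu * (p * q ^+ 2).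
    by rewrite tauE -/p; field; rewrite gt_eqF.
  by apply: ler_wpM2l => //; rewrite mulr_ge0 ?ltW.
have lin_ge : tau * (mu * d ^+ 2) <= tau * dot (gradient f u) (u - ustar).
  by rewrite ler_pM2l.
rewrite addrAC sqr_l2normBZ -/d.
apply: (@le_trans _ _ ((1 + - (tau * mu)) * d ^+ 2)); first lra.
by apply: ler_wpM2r; [exact: sqr_ge0 | exact: expR_ge1Dx].
Qed.

(** The bound [delta] is part of the induction because the contraction of the
next step is only available inside the [delta]-ball. *)
Lemma gradient_descent_contracts (R : realType) (n : nat) (f : 'rV[R]_n -> R)
    (mu alpha beta delta eps tau : R) (ustar u0 : 'rV[R]_n) (K : nat) :
  0 < mu -> strongly_convex mu f -> gradient f ustar = 0 ->
  alpha <= 1 -> 0 < beta -> holder_class alpha beta delta (gradient f) ->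
  0 < eps -> l2norm (u0 - ustar) <= delta ->
  tau = mu * beta ^- 2 * eps `^ (2 - 2 * alpha) ->
  let d k := l2norm (gradient_descent f tau u0 k - ustar) in
  (forall k, (k < K)%N -> eps <= d k) ->
  d K <= delta /\ d K ^+ 2 <= expR (- (K%:R * (tau * mu))) * d 0 ^+ 2.
Proof.
move=> mu_gt0 f_sc g0 alpha_le1 beta_gt0 fH eps_gt0 u0_close tauE d.
elim: K => [_|K IHK far].
  by split; [exact: u0_close | rewrite mul0r oppr0 expR0 mul1r].
have [dK_le dK_sqr_le] := IHK (fun k k_lt => far k (ltnW k_lt)).
have step : d K.+1 ^+ 2 <= expR (- (tau * mu)) * d K ^+ 2.
  exact: gradient_step_contracts (far K (ltnSn K)) dK_le tauE.
have tau_mu_ge0 : 0 <= tau * mu.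
  by rewrite ltW// tauE !mulr_gt0 ?invr_gt0 ?exprn_gt0 ?powR_gt0.
split.
  apply: le_trans dK_le; rewrite -ler_sqr ?nnegrE ?l2norm_ge0//.
  apply: le_trans step _; rewrite ler_piMl ?sqr_ge0//.
  by rewrite -expR0 ler_expR oppr_le0.
apply: le_trans step _.
have -> : - (K.+1%:R * (tau * mu)) = - (tau * mu) + - (K%:R * (tau * mu)).
  by rewrite -natr1; ring.
by rewrite expRD -mulrA ler_pM2l ?expR_gt0.
Qed.

Theorem theorem3 (R : realType) (n : nat) (f : 'rV[R]_n -> R)
    (mu alpha beta delta : R) (ustar u0 : 'rV[R]_n)
    (f_C1 : continuously_differentiable f)
    (mu_gt0 : 0 < mu)
    (f_sc : strongly_convex mu f)
    (ustar_min : minimizer f ustar)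
    (alpha_gt0 : 0 < alpha) (alpha_le1 : alpha <= 1)
    (beta_gt0 : 0 < beta) (delta_gt0 : 0 < delta)
    (grad_holder : holder_class alpha beta delta (gradient f))
    (u0_close : l2norm (u0 - ustar) <= delta) :
  exists2 eps0 : R, 0 < eps0 &
    forall eps : R, 0 < eps -> eps < eps0 ->
      let tau := mu * beta ^- 2 * eps `^ (2 - 2 * alpha) in
      exists k : nat,
        k%:Z <= Num.ceil (2 * beta ^+ 2 / mu ^+ 2
                          * ln (l2norm (u0 - ustar) / eps)
                          * eps `^ (2 * alpha - 2)) /\
        l2norm (gradient_descent f tau u0 k - ustar) <= eps.
Proof.
have g0 : gradient f ustar = 0 := gradient_minimizer f_C1.1 ustar_min.
set d0 := l2norm (u0 - ustar).
have [d0_eq0|d0_neq0] := eqVneq d0 0.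
  (* Here [ln (0 / eps)] is the junk value [0], so the allowed number of
     iterations is 0. *)
  exists 1 => // eps eps_gt0 _ tau; exists 0%N; split.
    by rewrite d0_eq0 mul0r ln0// mulr0 mul0r ceil0.
  by rewrite /= -/d0 d0_eq0 ltW.
have d0_gt0 : 0 < d0 by rewrite lt_def d0_neq0 l2norm_ge0.
exists d0 => // eps eps_gt0 eps_lt tau.
set L := ln (d0 / eps).
set N := (X in Num.ceil X).
have tau_mu_gt0 : 0 < tau * mu.
  by rewrite !mulr_gt0 ?invr_gt0 ?exprn_gt0 ?powR_gt0.
(* The announced count is exactly what drives [expR (- (N * (tau * mu)))] down
   to [(eps / d0) ^+ 2]. *)
have NE : N * (tau * mu) = 2 * L.
  rewrite /N /tau -[2 * alpha - 2]opprB powRN.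
  have p_neq0 : eps `^ (2 - 2 * alpha) != 0 by rewrite gt_eqF ?powR_gt0.
  by field; rewrite p_neq0 !gt_eqF.
have L_ge0 : 0 <= L by rewrite ln_ge0// ler_pdivlMr// mul1r ltW.
have N_ge0 : 0 <= N by rewrite -(pmulr_lge0 _ tau_mu_gt0) NE mulr_ge0.
have ceil_ge0 : 0 <= Num.ceil N by rewrite ceil_ge0 (lt_le_trans _ N_ge0).
have [K KE] : exists K : nat, K%:Z = Num.ceil N.
  by exists `|Num.ceil N|%N; rewrite gez0_abs.
have N_le : N <= K%:R by rewrite (_ : K%:R = (K%:Z)%:~R) // KE ceil_ge.
rewrite -KE.
have [[k [k_lt k_close]]|far] := pselect (exists k : nat, (k < K)%N /\
    l2norm (gradient_descent f tau u0 k - ustar) <= eps).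
  by exists k; split => //; rewrite lez_nat ltnW.
exists K; split => //.
have {}far k : (k < K)%N ->
    eps <= l2norm (gradient_descent f tau u0 k - ustar).
  move=> k_lt; rewrite leNgt; apply/negP => k_close; apply: far.
  by exists k; rewrite ltW.
have [_] := gradient_descent_contracts mu_gt0 f_sc g0 alpha_le1 beta_gt0
  grad_holder eps_gt0 u0_close (erefl tau) far.
rewrite -/tau -/d0 => dK_le.
rewrite -ler_sqr ?nnegrE ?l2norm_ge0 ?(ltW eps_gt0)//.
apply: le_trans dK_le _.
have epsE : eps = expR (- L) * d0.
  by rewrite expRN lnK ?posrE ?divr_gt0// invf_div mulfVK.
rewrite [in leRHS]epsE exprMn -expRM_natl ler_pM2r ?exprn_gt0// ler_expR.
by rewrite mulrN lerN2 -NE ler_pM2r.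
Qed.
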